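(* Let $P\in\{\textsf{LEV-ORD},\textsf{ASS-ORD},\textsf{ASS-R-ORD},\textsf{ANY-ORD}\}$ and $R\in\{\textsf{RED},\textsf{NO-RED}\}$. Then $\mathsf{QCDCL}^{P}_{R}$ is p-simulated by long-distance Q-resolution, and if $R=\textsf{NO-RED}$ it is even p-simulated by Q-resolution. In fact, for every $\mathsf{QCDCL}^{P}_{R}$ proof $\iota$ of a clause $C$ from a QCNF $\Phi$ there is a long-distance Q-resolution proof (a Q-resolution proof if $R=\textsf{NO-RED}$) $\pi$ of $C$ from $\Phi$ with $|\pi|\in\mathcal{O}(|\iota|)$. In particular, all these QCDCL proof systems are sound.
   Context: QBF basics. A literal is a variable $x$ or $\bar x$; a clause is a disjunction of literals identified with its set of literals; $(\bot)$ is the empty clause; tautological clauses contain $x$ and $\bar x$. A QCNF is $\Phi=\mathcal{Q}\cdot\phi$ with prefix $\mathcal{Q}=Q_1X_1\dots Q_sX_s$ (disjoint nonempty variable sets, alternating $Q_i\in\{\exists,\forall\}$) and matrix $\phi$ a CNF of non-tautological clauses. $\mathrm{lv}(x)=i$ if the variable of $x$ is in $X_i$; existential/universal variables are those in $\exists$/$\forall$-blocks. $\mathrm{red}(C)$ deletes from $C$ every universal literal $v$ with $\mathrm{lv}(v)>\mathrm{lv}(x)$ for all existential $x\in C$. For existential $\ell$ whose variable is not in $C_1,C_2$: $(C_1\vee\ell)\otimes_\ell(C_2\vee\bar\ell)=C_1\vee C_2$. A Q-resolution proof of $C$ is a sequence $C_1,\dots,C_m=C$ with each $C_i\in\phi$,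 or a non-tautological resolvent $C_j\otimes_x C_k$ ($j,k<i$, $x$ existential), or $\mathrm{red}(C_j)$. A long-distance Q-resolution proof is the same except that resolvents may contain complementary universal literals $u,\bar u$, provided that whenever variable $u$ occurs in both parents, $\mathrm{lv}(u)>\mathrm{lv}(x)$ for the pivot $x$. Size = number of clauses. QCDCL. $C|_\sigma=\top$ if $C\cap\sigma\neq\emptyset$, else the clause of all $\ell\in C$ with $\bar\ell\notin\sigma$. A trail for $\Phi=\mathcal{Q}\cdot\phi$ is $\mathcal{T}=(p_{(0,1)},\dots,p_{(0,g_0)};d_1,p_{(1,1)},\dots,p_{(1,g_1)};\dots;d_r,p_{(r,1)},\dots,p_{(r,g_r)})$, a sequence of literals with no variable occurring twice; $d_i$ decision literals, $p_{(i,j)}$ propagated literals (existential, or $\bot$ only as last element: a conflict). $\mathcal{T}[s,t]$: initial segment ending at $p_{(s,t)}$ (at $d_s$ if $t=0$; $\mathcal{T}[0,0]$ empty); $|\mathcal{T}|$: number of elements. Each $p_{(i,j)}$ has an antecedent $\mathrm{ante}(p_{(i,j)})\in\phi$ with: under RED, $\mathrm{red}(\mathrm{ante}(p_{(i,j)})|_{\mathcal{T}[i,j-1]})=(p_{(i,j)})$; under NO-RED, $\mathrm{ante}(p_{(i,j)})|_{\mathcal{T}[i,j-1]}=(p_{(i,j)})$ ($(\bot)$ = empty clause). Decision policies: LEV-ORD: $\mathrm{lv}(d_i)\le\mathrm{lv}(x)$ for all variables $x$ of $\phi$ unassigned in $\mathcal{T}[i-1,g_{i-1}]$; ASS-ORD: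 existential literals may always be decided, a universal $d_k$ only if $\mathrm{lv}(d_1)\le\dots\le\mathrm{lv}(d_k)$; ASS-R-ORD: an existential literal $x$ may be decided only if every universal variable $u$ with $\mathrm{lv}(u)<\mathrm{lv}(x)$ has already been decided; ANY-ORD: no restriction. A clause $C$ is unit under RED if $\mathrm{red}(C)=(x)$, $x$ existential, or $\mathrm{red}(C)$ empty ($x=\bot$); under NO-RED if $C=(x)$, $x$ existential, or $C$ empty. Natural condition at an initial segment without $\bot$: if some clauses of the current clause set are unit under it, the next element is the literal of one of them with that clause as antecedent, and is $\bot$ if possible; natural trail: holds at all initial segments. Learnable clauses of a trail ending in $\bot$: $C_{(r,g_r)}=\mathrm{red}(\mathrm{ante}(\bot))$; leftwards over propagated $p$, with $C'$ the clause of the next propagated literal to the right, the clause of $p$ is $\mathrm{red}(C'\otimes_p\mathrm{red}(\mathrm{ante}(p)))$ if $\bar p\in C'$, else $C'$; $\mathcal{L}_\mathcal{T}$ is this sequence, each clause with the derivation given by these steps. A $\mathsf{QCDCL}^{P}_{R}$ proof of $C$ from $\Phi$ is $\iota=((\mathcal{T}_1,\dots,\mathcal{T}_m),(C_1,\dots,C_m),(\pi_1,\dots,\pi_m))$: each $\mathcal{T}_i$ a trail following $P,R$ for $\mathcal{Q}\cdot(\phi\cup\{C_1,\dots,C_{i-1}\})$ that has run into a conflict, $C_i\in\mathcal{L}_{\mathcal{T}_i}$ with derivation $\pi_i$, $C_m=C$, $\mathcal{T}_1$ natural, and for $i\ge2$ some $(s,t)$ with $\mathcal{T}_i[s,t]=\mathcal{T}_{i-1}[s,t]$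 such that $\mathcal{T}_i$ satisfies the natural condition at all initial segments extending $\mathcal{T}_i[s,t]$. Size $|\iota|=\sum_i|\mathcal{T}_i|$. A proof system $g$ p-simulates $f$ if every $f$-proof can be transformed in polynomial time into a $g$-proof of the same formula. Soundness: only false QCNFs have refutations (proofs of $(\bot)$). *)

(* Defs.v *)
From HB Require Import structures.
From Corelib Require Import BinNums.
From mathcomp Require Import all_boot.
From mathcomp Require Import finmap.

Set Implicit Arguments.
Unset Strict Implicit.
Unset Printing Implicit Defensive.

Local Open Scope fset_scope.

(** * QBF basics *)

(* The literal of variable x is (x, true), its complement is (x, false). *)
Definition var := nat.
Definition lit : Type := (var * bool)%type.
Definition neg (l : lit) : lit := (l.1, ~~ l.2).
Definition clause := {fset lit}.

Definition taut (C : clause) : bool := has (fun l => neg l \in C) (enum_fset C).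
Definition occurs (x : var) (C : clause) : bool :=
  ((x, true) \in C) || ((x, false) \in C).

(* A quantifier block (q, X); q = true stands for an existential block. *)
Definition block : Type := (bool * {fset var})%type.
Definition qbf_prefix := seq block.

Definition existential (Q : qbf_prefix) (x : var) : bool :=
  has (fun b : block => b.1 && (x \in b.2)) Q.
Definition universal (Q : qbf_prefix) (x : var) : bool :=
  has (fun b : block => ~~ b.1 && (x \in b.2)) Q.
Definition in_prefix (Q : qbf_prefix) (x : var) : bool :=
  has (fun b : block => x \in b.2) Q.

(* Levels are numbered from 1; only meaningful when in_prefix Q x. *)
Definition lv (Q : qbf_prefix) (x : var) : nat :=
  (find (fun b : block => x \in b.2) Q).+1.

Definition wf_prefix (Q : qbf_prefix) : bool :=
  [&& all (fun b : block => b.2 != fset0) Q,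
      sorted (fun b c : block => b.1 != c.1) Q
    & pairwise (fun b c : block => [disjoint b.2 & c.2]) Q].

Definition wf_matrix (Q : qbf_prefix) (phi : {fset clause}) : bool :=
  all (fun C : clause =>
         ~~ taut C && all (fun l : lit => in_prefix Q l.1) (enum_fset C))
      (enum_fset phi).

Record qcnf := QCNF {
  qprefix : qbf_prefix;
  qmatrix : {fset clause};
  qcnf_wf : wf_prefix qprefix && wf_matrix qprefix qmatrix }.

Definition clause_true (s : var -> bool) (C : clause) : Prop :=
  exists2 l, l \in C & s l.1 = l.2.

Fixpoint sem (phi : {fset clause}) (Q : qbf_prefix) (s : var -> bool) : Prop :=
  match Q with
  | [::] => forall C, C \in phi -> clause_true s C
  | (true, X) :: Q' =>
      exists2 t : var -> bool, (forall x, x \notin X -> t x = s x) & sem phi Q' t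
  | (false, X) :: Q' =>
      forall t : var -> bool, (forall x, x \notin X -> t x = s x) -> sem phi Q' t
  end.

(* The formula is closed, so the initial assignment is irrelevant. *)
Definition qcnf_true (Phi : qcnf) : Prop :=
  sem (qmatrix Phi) (qprefix Phi) (fun=> false).

Definition red (Q : qbf_prefix) (C : clause) : clause :=
  [fset v in C | ~~ (universal Q v.1 &&
     all (fun x : lit => existential Q x.1 ==> (lv Q x.1 < lv Q v.1)%N)
         (enum_fset C))].

(** * Q-resolution and long-distance Q-resolution *)

(* With C = C1 \/ l and D = C2 \/ neg l, where the variable of l is neither in
   C1 nor in C2, this is C1 \/ C2. *)
Definition resolvent (l : lit) (C D : clause) : clause :=
  (C `\ l) `|` (D `\ neg l).

Definition can_resolve (Q : qbf_prefix) (l : lit) (C D : clause) : bool :=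
  [&& existential Q l.1, l \in C, neg l \notin C, neg l \in D & l \notin D].

Definition qres_ok (Q : qbf_prefix) (l : lit) (C D : clause) : Prop :=
  ~~ taut (resolvent l C D).

Definition ldqres_ok (Q : qbf_prefix) (l : lit) (C D : clause) : Prop :=
  forall u : lit, u \in resolvent l C D -> neg u \in resolvent l C D ->
    universal Q u.1 /\
    (occurs u.1 C -> occurs u.1 D -> (lv Q l.1 < lv Q u.1)%N).

Definition res_proof (ok : qbf_prefix -> lit -> clause -> clause -> Prop)
    (Phi : qcnf) (C : clause) (pi : seq clause) : Prop :=
  let Q := qprefix Phi in
  [/\ (0 < size pi)%N, last fset0 pi = C &
      forall i, (i < size pi)%N ->
        let E := nth fset0 pi i in
        [\/ E \in qmatrix Phi,
            exists D1 D2 l, [/\ D1 \in take i pi, D2 \in take i pi,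
               can_resolve Q l D1 D2, ok Q l D1 D2 & E = resolvent l D1 D2]
          | exists2 D, D \in take i pi & E = red Q D]].

Definition qres_proof := res_proof qres_ok.
Definition ldqres_proof := res_proof ldqres_ok.

(** * QCDCL *)

Inductive policy := LevOrd | AssOrd | AssROrd | AnyOrd.
Inductive redmode := Red | NoRed.

(* A propagated literal, or the conflict, is stored with its antecedent.  The
   trail is a flat sequence: the segments T[s,t] are exactly the take k T with
   k <= size T. *)
Inductive item :=
  | Decide of lit
  | Propagate of lit & clause
  | Conflict of clause.
Definition trail := seq item.

Definition item_lit (it : item) : option lit :=
  match it with
  | Decide l => Some l
  | Propagate l _ => Some l
  | Conflict _ => None
  end.
Definition item_dec (it : item) : option lit :=
  if it is Decide l then Some l else None.
Definition is_conflict (it : item) : bool :=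
  if it is Conflict _ then true else false.

(* A trail element without its antecedent, None being the conflict. *)
Definition erase (it : item) : bool * option lit :=
  (isSome (item_dec it), item_lit it).

Definition lits (T : trail) : seq lit := pmap item_lit T.
Definition decisions (T : trail) : seq lit := pmap item_dec T.
Definition assigned (T : trail) (x : var) : bool := x \in map fst (lits T).

(* None is the satisfied clause. *)
Definition restrict (C : clause) (s : seq lit) : option clause :=
  if has (fun l => l \in C) s then None
  else Some [fset l in C | neg l \notin s].

Definition remaining (R : redmode) (Q : qbf_prefix) (C : clause) (s : seq lit) :
    option clause :=
  omap (fun D => if R is Red then red Q D else D) (restrict C s).

(* it is obtained by unit propagation, with antecedent in S, after the
   (initial segment of a) trail T. *)
Definition propagates (R : redmode) (Q : qbf_prefix) (S : {fset clause})
    (T : trail) (it : item) : bool :=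
  match it with
  | Decide _ => false
  | Propagate l A =>
      [&& A \in S, existential Q l.1 & remaining R Q A (lits T) == Some [fset l]]
  | Conflict A => (A \in S) && (remaining R Q A (lits T) == Some fset0)
  end.

Definition may_decide (P : policy) (Q : qbf_prefix) (S : {fset clause})
    (T : trail) (d : lit) : Prop :=
  match P with
  | LevOrd => forall C x, C \in S -> occurs x C -> ~~ assigned T x ->
                (lv Q d.1 <= lv Q x)%N
  | AssOrd => universal Q d.1 ->
                sorted leq [seq lv Q l.1 | l <- rcons (decisions T) d]
  | AssROrd => existential Q d.1 ->
                 forall u, universal Q u -> (lv Q u < lv Q d.1)%N ->
                   u \in map fst (decisions T)
  | AnyOrd => True
  end.

Definition is_trail (P : policy) (R : redmode) (Q : qbf_prefix)
    (S : {fset clause}) (T : trail) : Prop :=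
  uniq (map fst (lits T)) /\
  forall T1 it T2, T = T1 ++ it :: T2 ->
    match it with
    | Decide d => in_prefix Q d.1 /\ may_decide P Q S T1 d
    | Propagate _ _ => propagates R Q S T1 it
    | Conflict _ => propagates R Q S T1 it /\ T2 = [::]
    end.

Definition conflicting (T : trail) : Prop := exists T' A, T = rcons T' (Conflict A).

(* The natural condition at the initial segment of length k. *)
Definition natural_at (R : redmode) (Q : qbf_prefix) (S : {fset clause})
    (T : trail) (k : nat) : Prop :=
  ~~ has is_conflict (take k T) ->
  (exists it, propagates R Q S (take k T) it) ->
  exists it, [/\ onth T k = Some it, propagates R Q S (take k T) it &
    (exists A, propagates R Q S (take k T) (Conflict A)) -> is_conflict it].

Definition natural_from (R : redmode) (Q : qbf_prefix) (S : {fset clause})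
    (T : trail) (k : nat) : Prop :=
  forall j, (k <= j <= size T)%N -> natural_at R Q S T j.

(* The learnable clauses with their derivations.  T is read from right to left
   (i.e., it is given in reverse order), C is the clause of the next propagated
   literal to the right and pi its derivation. *)
Fixpoint learn (Q : qbf_prefix) (C : clause) (pi : seq clause) (T : trail) :
    seq (clause * seq clause) :=
  match T with
  | Propagate p A :: T' =>
      if neg p \in C then
        let E := resolvent (neg p) C (red Q A) in
        let pi' := pi ++ [:: A; red Q A; E; red Q E] in
        (red Q E, pi') :: learn Q (red Q E) pi' T'
      else (C, pi) :: learn Q C pi T'
  | _ :: T' => learn Q C pi T'
  | [::] => [::]
  end.

Definition learnable (Q : qbf_prefix) (T : trail) : seq (clause * seq clause) :=
  if rev T is Conflict A :: T' then
    (red Q A, [:: A; red Q A]) :: learn Q (red Q A) [:: A; red Q A] T'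
  else [::].

Record qcdcl_pf := QcdclPf {
  trails : seq trail;
  learned : seq clause;
  derivations : seq (seq clause) }.

Definition qcdcl_size (io : qcdcl_pf) : nat := sumn (map size (trails io)).

Definition qcdcl_proof (P : policy) (R : redmode) (Phi : qcnf) (C : clause)
    (io : qcdcl_pf) : Prop :=
  let Q := qprefix Phi in
  let m := size (trails io) in
  let T i := nth [::] (trails io) i in
  let S i := qmatrix Phi `|` [fset D in take i (learned io)] in
  [/\ [/\ (0 < m)%N, size (learned io) = m & size (derivations io) = m],
      last fset0 (learned io) = C,
      forall i, (i < m)%N ->
        [/\ is_trail P R Q (S i) (T i), conflicting (T i) &
            (nth fset0 (learned io) i, nth [::] (derivations io) i)
              \in learnable Q (T i)],
      natural_from R Q (S 0) (T 0) 0
    & forall i, (0 < i < m)%N ->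
        exists k, [/\ (k <= size (T i))%N, (k <= size (T i.-1))%N,
          map erase (take k (T i)) = map erase (take k (T i.-1)) &
          natural_from R Q (S i) (T i) k]].

(** * Polynomial time *)

(* Deterministic multi-tape Turing machines with two-way infinite tapes; the
   input is on the first tape, the output on the last one.  None is the blank,
   tm_aux the auxiliary part of the tape alphabet. *)
Inductive move := GoLeft | Stay | GoRight.

Record tm (A : finType) := TM {
  tm_last : nat;
  tm_aux : finType;
  tm_state : finType;
  tm_start : tm_state;
  tm_halt : pred tm_state;
  tm_trans : tm_state -> {ffun 'I_tm_last.+1 -> option (A + tm_aux)} ->
    tm_state * ('I_tm_last.+1 -> option (A + tm_aux) * move) }.

Section Machine.
Variables (A : finType) (M : tm A).

Definition cell : Type := option (A + tm_aux M).

(* (l, r): the scanned cell is the first one of r, l lists the cells to its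
   left from right to left; all other cells are blank. *)
Definition tape : Type := (seq cell * seq cell)%type.

Definition read (t : tape) : cell := head None t.2.

Definition write (t : tape) (a : cell * move) : tape :=
  let r := a.1 :: behead t.2 in
  match a.2 with
  | GoLeft => (behead t.1, head None t.1 :: r)
  | Stay => (t.1, r)
  | GoRight => (a.1 :: t.1, behead t.2)
  end.

Definition config : Type := (tm_state M * ('I_(tm_last M).+1 -> tape))%type.

Definition tm_step (c : config) : config :=
  if tm_halt c.1 then c
  else
    let: (q, a) := tm_trans c.1 [ffun i => read (c.2 i)] in
    (q, fun i => write (c.2 i) (a i)).

Definition word (w : seq A) : seq cell := [seq Some (inl a) | a <- w].

Definition tm_init (w : seq A) : config :=
  (tm_start M, fun i => ([::], if i == ord0 then word w else [::])).

Definition tm_output (c : config) (w : seq A) : Prop :=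
  exists a b, let t := c.2 ord_max in
    rev t.1 ++ t.2 = nseq a None ++ word w ++ nseq b None.

End Machine.

(* Halted configurations are fixed by tm_step, so "after n steps" below means
   "within n steps". *)
Definition polytime (A : finType) (f : seq A -> seq A) : Prop :=
  exists (M : tm A) (c d : nat), forall w : seq A,
    let e := iter (c * size w ^ d + c) (@tm_step A M) (tm_init M w) in
    tm_halt e.1 /\ tm_output e (f w).

(** * Encoding of proofs as words, and p-simulation *)

Inductive symbol :=
  | Bit of bool | Sign of bool | EndVar | EndBlock of bool | EndClause
  | MarkDecide | MarkPropagate | MarkConflict | EndSeq | EndSection.

Definition symbol_code (a : symbol) : 'I_10 * bool :=
  match a with
  | Bit b => (inord 0, b)
  | Sign b => (inord 1, b)
  | EndVar => (inord 2, true)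
  | EndBlock b => (inord 3, b)
  | EndClause => (inord 4, true)
  | MarkDecide => (inord 5, true)
  | MarkPropagate => (inord 6, true)
  | MarkConflict => (inord 7, true)
  | EndSeq => (inord 8, true)
  | EndSection => (inord 9, true)
  end.

Definition symbol_decode (c : 'I_10 * bool) : symbol :=
  match val c.1 with
  | 0 => Bit c.2
  | 1 => Sign c.2
  | 2 => EndVar
  | 3 => EndBlock c.2
  | 4 => EndClause
  | 5 => MarkDecide
  | 6 => MarkPropagate
  | 7 => MarkConflict
  | 8 => EndSeq
  | _ => EndSection
  end.

Lemma symbol_codeK : cancel symbol_code symbol_decode.
Proof. by case=> [b|b||b||||||]; rewrite /symbol_decode /= inordK. Qed.

HB.instance Definition _ := Finite.copy symbol (can_type symbol_codeK).

(* Binary notation, least significant bit first; 0 is the empty word. *)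
Fixpoint enc_positive (p : positive) : seq symbol :=
  match p with
  | xH => [:: Bit true]
  | xO q => Bit false :: enc_positive q
  | xI q => Bit true :: enc_positive q
  end.
Definition enc_var (x : var) : seq symbol :=
  if bin_of_nat x is Npos p then enc_positive p else [::].

Definition enc_lit (l : lit) : seq symbol := rcons (enc_var l.1) (Sign l.2).
Definition enc_clause (C : clause) : seq symbol :=
  rcons (flatten (map enc_lit (enum_fset C))) EndClause.
Definition enc_clauses (s : seq clause) : seq symbol :=
  flatten (map enc_clause s).
Definition enc_block (b : block) : seq symbol :=
  rcons (flatten [seq rcons (enc_var x) EndVar | x <- enum_fset b.2])
        (EndBlock b.1).
Definition enc_qcnf (Phi : qcnf) : seq symbol :=
  rcons (flatten (map enc_block (qprefix Phi))
           ++ enc_clauses (enum_fset (qmatrix Phi))) EndSection.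
Definition enc_item (it : item) : seq symbol :=
  match it with
  | Decide l => MarkDecide :: enc_lit l
  | Propagate l A => MarkPropagate :: enc_lit l ++ enc_clause A
  | Conflict A => MarkConflict :: enc_clause A
  end.
Definition enc_trail (T : trail) : seq symbol :=
  rcons (flatten (map enc_item T)) EndSeq.

(* As usual, a proof word contains the formula. *)
Definition enc_res_proof (Phi : qcnf) (pi : seq clause) : seq symbol :=
  enc_qcnf Phi ++ enc_clauses pi.
Definition enc_qcdcl_proof (Phi : qcnf) (io : qcdcl_pf) : seq symbol :=
  enc_qcnf Phi
    ++ rcons (flatten (map enc_trail (trails io))) EndSection
    ++ rcons (enc_clauses (learned io)) EndSection
    ++ flatten [seq rcons (enc_clauses pi) EndSeq | pi <- derivations io].

(* ps_proves Phi C p: p is a proof of the clause C from Phi, hence a refutation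
   of Phi when C is empty. *)
Record proof_system := ProofSystem {
  ps_proof : Type;
  ps_proves : qcnf -> clause -> ps_proof -> Prop;
  ps_encode : qcnf -> ps_proof -> seq symbol }.

Definition Qres : proof_system := ProofSystem qres_proof enc_res_proof.
Definition LDQres : proof_system := ProofSystem ldqres_proof enc_res_proof.
Definition QCDCL (P : policy) (R : redmode) : proof_system :=
  ProofSystem (qcdcl_proof P R) enc_qcdcl_proof.

Definition p_simulates (g f : proof_system) : Prop :=
  exists2 F : seq symbol -> seq symbol, polytime F &
    forall (Phi : qcnf) (C : clause) (p : ps_proof f), ps_proves Phi C p ->
      exists2 q : ps_proof g, ps_proves Phi C q &
        F (ps_encode Phi p) = ps_encode Phi q.

Definition sound (f : proof_system) : Prop :=
  forall (Phi : qcnf) (p : ps_proof f), ps_proves Phi fset0 p -> ~ qcnf_true Phi.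

(* Main.v *)
Require Import Defs.
From mathcomp Require Import all_boot.
From mathcomp Require Import finmap.

Set Implicit Arguments.
Unset Strict Implicit.
Unset Printing Implicit Defensive.

Local Open Scope fset_scope.

(** The derivations attached to the learned clauses, concatenated, already form
    a resolution proof: an antecedent that is a previously learned clause [A]
    satisfies [A = red A], so it is rejustified as a reduction of its earlier
    occurrence.  The resolution steps are legal because every existential
    literal of a learnable clause is falsified by the trail, and a literal of
    the antecedent of [p] is [p], or falsified before [p], or (under RED only) a
    universal literal to the right of [p].  Since the derivations are part of
    the QCDCL proof, a one-pass finite transducer computes the translation.

    Soundness is that of long-distance Q-resolution, by induction on the blocks
    of the prefix: a refutation survives every assignment of an outermost
    existential block, and some assignment of an outermost universal block. *)

(** * Literals, reduction and resolvents *)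

Lemma negK : involutive neg.
Proof. by case=> x b; rewrite /neg /= negbK. Qed.

Lemma neg_neq (l : lit) : (neg l == l) = false.
Proof. by case: l => x []; apply/negP => /eqP []. Qed.

Lemma lit_eq_var (l m : lit) : l.1 = m.1 -> l = m \/ l = neg m.
Proof.
case: l m => x b [y c] /= ->; rewrite /neg /=.
by case: b; case: c; [left | right | right | left].
Qed.

Lemma occursP (x : var) (C : clause) :
  reflect (exists2 l, l \in C & l.1 = x) (occurs x C).
Proof.
apply: (iffP orP) => [[h|h]|[[y []] h /= <-]]; [| |by left|by right].
- by exists (x, true).
- by exists (x, false).
Qed.

Lemma tautP (C : clause) :
  reflect (exists2 l, l \in C & neg l \in C) (taut C).
Proof. exact: hasP. Qed.

Lemma in_red Q (C : clause) (l : lit) :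
  reflect (l \in C /\ (universal Q l.1 ->
             exists x, [/\ x \in C, existential Q x.1 &
               (lv Q l.1 <= lv Q x.1)%N]))
          (l \in red Q C).
Proof.
rewrite !inE; apply: (iffP andP) => [[-> /=]|[-> h]]; split=> //.
  move=> hu; move: b; rewrite hu /= => /allPn[x xC].
  by rewrite negb_imply -leqNgt => /andP[ex le]; exists x.
apply/negP => /andP[/h[x [xC ex le]] /allP/(_ x xC)].
by rewrite ex /= ltnNge le.
Qed.

Lemma red_sub Q C : {subset red Q C <= C}.
Proof. by move=> l /in_red[]. Qed.

Lemma red_existential Q (C : clause) (l : lit) :
  existential Q l.1 -> l \in C -> l \in red Q C.
Proof. by move=> ex lC; apply/in_red; split=> // _; exists l. Qed.

Lemma red_mono Q (C D : clause) :
  {subset C <= D} -> {subset red Q C <= red Q D}.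
Proof.
move=> sCD l /in_red[/sCD lD h]; apply/in_red; split=> // /h[x [/sCD xD ex le]].
by exists x.
Qed.

Lemma red_idem Q C : red Q (red Q C) = red Q C.
Proof.
apply/fsetP => l; apply/idP/idP; first exact: red_sub.
move=> lr; apply/in_red; split=> // /(proj2 (elimT (in_red _ _ _) lr)).
by case=> x [xC ex le]; exists x; split=> //; apply: red_existential.
Qed.

(** That [l] is not existential comes from the level condition applied to [l] itself. *)
Lemma red_removed Q (C : clause) (l : lit) :
  l \in C -> l \notin red Q C ->
  [/\ universal Q l.1, ~~ existential Q l.1 &
      forall x : lit, x \in C -> existential Q x.1 -> (lv Q x.1 < lv Q l.1)%N].
Proof.
move=> lC; rewrite !inE lC /= negbK => /andP[-> /allP h].
split=> // [|x xC ex]; last by move: (h _ xC); rewrite ex.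
by apply/negP => el; move: (h _ lC); rewrite el ltnn.
Qed.

Lemma in_resolvent (l m : lit) (C D : clause) :
  (m \in resolvent l C D) =
  (m != l) && (m \in C) || (m != neg l) && (m \in D).
Proof. by rewrite !inE. Qed.

(** * Derivations as sequences of clauses *)

Section Derivations.
Variables (ok : qbf_prefix -> lit -> clause -> clause -> Prop) (Phi : qcnf).
Let Q := qprefix Phi.

(** The step condition of [res_proof] relative to an arbitrary list of available clauses, so that
    derivations can be extended clause by clause. *)
Definition justified (pi : seq clause) (E : clause) : Prop :=
  [\/ E \in qmatrix Phi,
      exists D1 D2 l, [/\ D1 \in pi, D2 \in pi,
         can_resolve Q l D1 D2, ok Q l D1 D2 & E = resolvent l D1 D2]
    | exists2 D, D \in pi & E = red Q D].

Definition derivation (pi : seq clause) : Prop :=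
  forall i, (i < size pi)%N -> justified (take i pi) (nth fset0 pi i).

Lemma derivation_rcons pi E :
  derivation pi -> justified pi E -> derivation (rcons pi E).
Proof.
move=> dpi jE i; rewrite size_rcons ltnS leq_eqVlt => /predU1P[->|lti].
  by rewrite -cats1 take_size_cat // nth_cat ltnn subnn.
by rewrite nth_rcons lti -cats1 takel_cat 1?ltnW //; apply: dpi.
Qed.

End Derivations.

Lemma qres_ldqres_ok Q l C D : qres_ok Q l C D -> ldqres_ok Q l C D.
Proof. by move=> /tautP nt u uE nuE; case: nt; exists u. Qed.

Lemma qres_ldqres Phi C pi : qres_proof Phi C pi -> ldqres_proof Phi C pi.
Proof.
case=> pos lst h; split=> // i /h [? | [D1 [D2 [l [? ? ? ok ?]]]] | ?].
- exact: Or31.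
- by apply: Or32; exists D1, D2, l; split=> //; apply: qres_ldqres_ok.
- exact: Or33.
Qed.

(** * Clause learning *)

Definition mode_ok (R : redmode) :=
  if R is Red then ldqres_ok else qres_ok.

(** The only literals of a learnable clause that the trail may leave unfalsified. Under [NoRed]
    there are none, which is why resolvents are then non-tautological. *)
Definition reducible (R : redmode) (Q : qbf_prefix) (l : lit) : Prop :=
  [/\ R = Red, universal Q l.1 & ~~ existential Q l.1].

Lemma lits_cat T1 T2 : lits (T1 ++ T2) = lits T1 ++ lits T2.
Proof. exact: pmap_cat. Qed.

Lemma trail_consistent (s : seq lit) (l : lit) :
  uniq (map fst s) -> l \in s -> neg l \in s -> False.
Proof.
elim: s => //= m s IH /andP[nm us]; rewrite !inE.
move=> /predU1P[->|ls] /predU1P[e|ns]; last exact: IH.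
- by move/eqP: e; rewrite neg_neq.
- by case/negP: nm; apply/mapP; exists (neg m).
- by case/negP: nm; apply/mapP; exists l => //; rewrite -e.
Qed.

Lemma remaining_sub R Q A s B (l : lit) :
  remaining R Q A s = Some B -> l \in A ->
  l \notin s /\ ([\/ neg l \in s, l \in B |
    reducible R Q l /\ forall x : lit, x \in B -> existential Q x.1 ->
       (lv Q x.1 < lv Q l.1)%N]).
Proof.
rewrite /remaining /restrict; case: ifP => // /hasPn h [<-] lA.
split; first by apply: contraL lA => /h.
have [|nls] := boolP (neg l \in s); first by constructor 1.
have lD : l \in [fset m in A | neg m \notin s] by rewrite !inE lA.
case: R => //; last by constructor 2.
set D := [fset m in A | _] in lD *.
have [|lr] := boolP (l \in red Q D); first by constructor 2.
have [u ne hx] := red_removed lD lr; constructor 3; split=> // x /red_sub.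
exact: hx.
Qed.

Lemma remaining_mem R Q A s B (l : lit) :
  remaining R Q A s = Some B -> l \in B -> l \in A.
Proof.
rewrite /remaining /restrict; case: ifP => // _ [<-].
by case: R => [/red_sub|]; rewrite !inE => /andP[].
Qed.

Section Learning.
Variables (P : policy) (R : redmode) (Phi : qcnf) (S : {fset clause}).
Variables (T : trail) (pi0 : seq clause).
Let Q := qprefix Phi.
Hypothesis trailT : is_trail P R Q S T.
Hypothesis derivation0 : derivation (mode_ok R) Phi pi0.
Hypothesis justS : forall A pi, A \in S ->
  justified (mode_ok R) Phi (pi0 ++ pi) A.

(* A literal of a learnable clause may become true later on the trail if it is
   universal, but not before the position reached by the learning process. *)
Let refuted (T1 : trail) (C : clause) : Prop :=
  forall l, l \in C -> l \notin lits T1 /\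
    (neg l \in lits T \/ reducible R Q l).

(** [C] must end the derivation to be available as a parent of the next step, and must be reduced so
    that a later trail can reuse it as the reduction of itself. *)
Let derived (C : clause) (pi : seq clause) : Prop :=
  [/\ derivation (mode_ok R) Phi (pi0 ++ pi), red Q C = C &
      exists pi', pi = rcons pi' C].

(** The trail is consistent, so it cannot falsify both of two complementary literals: a clash in the
    resolvent can only be on a reducible variable. The level condition then concerns the occurrence
    of that variable in [A]. *)
Lemma resolve_antecedent T1 p A T2 C :
  T = T1 ++ Propagate p A :: T2 -> refuted (rcons T1 (Propagate p A)) C ->
  neg p \in C ->
  let E := resolvent (neg p) C (red Q A) in
  [/\ can_resolve Q (neg p) C (red Q A), mode_ok R Q (neg p) C (red Q A) &
      refuted T1 E].
Proof.
move=> eT refC npC /=; have [unT /(_ _ _ _ eT) /= /and3P[AS exp /eqP rem]] := trailT.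
have eL : lits T = lits T1 ++ p :: lits T2 by rewrite eT lits_cat.
have pT : p \in lits T by rewrite eL mem_cat inE eqxx orbT.
have subT l : l \in lits T1 -> l \in lits T by rewrite eL mem_cat => ->.
have pT1 : p \notin lits T1.
  apply/negP => h; move: unT; rewrite eL map_cat cat_uniq /= => /and3P[_ + _].
  by rewrite negb_or => /andP[/negP + _]; apply; apply/mapP; exists p.
have npT1 : neg p \notin lits T1.
  by apply/negP => /subT; apply: trail_consistent unT pT.
have litA l : l \in A -> l \notin lits T1 /\ [\/ neg l \in lits T1, l = p |
    reducible R Q l /\ (lv Q p.1 < lv Q l.1)%N].
  move=> lA; have [-> h] := remaining_sub rem lA; split=> //.
  case: h => [|/fset1P|[? h]]; [by constructor 1|by constructor 2|].
  by constructor 3; split=> //; apply: h; rewrite ?inE.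
have litC l : l \in C -> l \notin lits T1 /\ (neg l \in lits T \/ reducible R Q l).
  move=> /refC []; rewrite -cats1 lits_cat mem_cat negb_or => /andP[? _].
  by split.
have pC : p \notin C.
  apply/negP => /litC[_ [|[_ _]]]; last by rewrite exp.
  exact: trail_consistent unT pT.
have pA : p \in A by apply: (remaining_mem rem); rewrite inE.
have npA : neg p \notin red Q A.
  apply/negP => /red_sub/litA[_]; rewrite negK => -[|/eqP|[[_ _]]].
  - by rewrite (negbTE pT1).
  - by rewrite neg_neq.
  - by rewrite /= exp.
have refE : refuted T1 (resolvent (neg p) C (red Q A)).
  move=> l; rewrite in_resolvent negK => /orP[/andP[_ /litC]//|/andP[lp]].
  move=> /red_sub/litA[-> [/subT|e|[r _]]]; split=> //; [by left| |by right].
  by rewrite e eqxx in lp.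
split=> //.
  by rewrite /can_resolve /= exp npC negK pC red_existential.
have clash l : l \in resolvent (neg p) C (red Q A) ->
    neg l \in resolvent (neg p) C (red Q A) -> reducible R Q l.
  move=> /refE[_ [nl|//]] /refE[_ [|//]]; rewrite negK => lT.
  by case: (trail_consistent unT lT nl).
rewrite /mode_ok; case eR: R; last first.
  by apply/tautP => -[l lE /(clash l lE) []]; rewrite eR.
move=> u uE nuE; have [_ uu _] := clash u uE nuE; split=> // _.
move=> /occursP[w /red_sub wA wu].
(* The literal [w] of [A] may be either of the clashing pair. If it were falsified before [p], then
   [neg w] would be true there, against [refE]; so [w] lies to the right of [p]. *)
have [wE nwE] : w \in resolvent (neg p) C (red Q A) /\
                neg w \in resolvent (neg p) C (red Q A).
  by case: (lit_eq_var wu) => ->; rewrite ?negK.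
rewrite -wu; have [_ [nw|e|[]//]] := litA w wA.
  by have [] := refE _ nwE; rewrite nw.
by move: wE; rewrite e in_resolvent negK eqxx (negbTE pC) andbF.
Qed.

(** Induction on the part of the trail still to be read, [T2] being the part already processed. A
    resolution step appends the four clauses [A], [red Q A], [E], [red Q E], whence the factor 4. *)
Lemma learn_derived Tr C pi T2 :
  T = rev Tr ++ T2 -> refuted (rev Tr) C -> derived C pi ->
  forall D pi', (D, pi') \in learn Q C pi Tr ->
  derived D pi' /\ (size pi' <= size pi + 4 * size Tr)%N.
Proof.
elim: Tr C pi T2 => [//|it Tr IH] C pi T2; rewrite rev_cons cat_rcons.
move=> eT refC dC D pi'.
have weak C' : refuted (rcons (rev Tr) it) C' -> refuted (rev Tr) C'.
  move=> h l /h[]; rewrite -cats1 lits_cat mem_cat negb_or => /andP[? _].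
  by split.
have skip : (D, pi') \in learn Q C pi Tr ->
    derived D pi' /\ (size pi' <= size pi + 4 * (size Tr).+1)%N.
  move=> /(IH _ _ _ eT (weak _ refC) dC) [? le]; split=> //.
  by apply: leq_trans le _; rewrite leq_add2l leq_mul2l leqnSn.
case: it eT refC weak => [d|p A|A] eT refC weak; [exact: skip| |exact: skip].
rewrite /=; case: ifP => npC; last first.
  rewrite inE => /predU1P[[-> ->]|]; last exact: skip.
  by split=> //; rewrite leq_addr.
have [cr okr refE] := resolve_antecedent eT refC npC.
set E := resolvent _ _ _ in refE *; set pi1 := pi ++ _.
have AS : A \in S by have [_ /(_ _ _ _ eT) /= /and3P[]] := trailT.
have sz1 : size pi1 = (size pi + 4)%N by rewrite size_cat.
have d1 : derived (red Q E) pi1.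
  case: dC => dC rC [pi'' epi]; split; [|exact: red_idem|]; last first.
    by exists (pi ++ [:: A; red Q A; E]); rewrite -cats1 -catA.
  rewrite /pi1 -[[:: A; _; _; _]]/([:: A] ++ [:: red Q A] ++ [:: E] ++ [:: red Q E]).
  rewrite !catA !cats1; apply: derivation_rcons; last first.
    by apply: Or33; exists E; rewrite // mem_rcons mem_head.
  apply: derivation_rcons; last first.
    apply: Or32; exists C, (red Q A), (neg p); split=> //.
      rewrite mem_rcons inE mem_rcons inE mem_cat epi mem_rcons mem_head.
      by rewrite !orbT.
    by rewrite mem_rcons mem_head.
  apply: derivation_rcons; last first.
    by apply: Or33; exists A; rewrite // mem_rcons mem_head.
  by apply: derivation_rcons; last exact: justS.
have ref1 : refuted (rev Tr) (red Q E) by move=> l /red_sub/refE.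
rewrite inE => /predU1P[[-> ->]|].
  by split=> //; rewrite sz1 mulnS leq_add2l leq_addr.
by move=> /(IH _ _ _ eT ref1 d1)[? le]; split=> //; rewrite mulnS addnA -sz1.
Qed.

(** The two initial clauses are paid for by the conflict, which is itself an element of the
    trail. *)
Lemma learnable_derived D pi :
  (D, pi) \in learnable Q T ->
  derived D pi /\ (size pi <= 4 * size T)%N.
Proof.
rewrite /learnable; case erT: (rev T) => [//|[//|//|A] Tr].
have eT : T = rev Tr ++ [:: Conflict A] by rewrite -[T]revK erT rev_cons cats1.
have [_ /(_ _ _ _ eT) /= [/andP[AS /eqP rem] _]] := trailT.
have szT : size T = (size Tr).+1 by rewrite -(size_rev T) erT.
have refA : refuted (rev Tr) (red Q A).
  move=> l /red_sub lA; have [-> h] := remaining_sub rem lA; split=> //.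
  by case: h => [nl|//|[]]; [left; rewrite eT lits_cat mem_cat nl | right].
have dA : derived (red Q A) [:: A; red Q A].
  split; [|exact: red_idem|by exists [:: A]].
  rewrite -[[:: A; _]]/([:: A] ++ [:: red Q A]) catA !cats1.
  apply: derivation_rcons.
    by apply: derivation_rcons => //; rewrite -[pi0]cats0; apply: justS.
  by apply: Or33; exists A; rewrite // mem_rcons mem_head.
rewrite inE szT => /predU1P[[-> ->]|]; first by split; rewrite ?mulnS.
move=> /(learn_derived eT refA dA)[? le]; split=> //; apply: leq_trans le _.
by rewrite mulnS leq_add2r.
Qed.

End Learning.

Lemma qcdcl_derivation P R Phi C io : qcdcl_proof P R Phi C io ->
  res_proof (mode_ok R) Phi C (flatten (derivations io)) /\
  (size (flatten (derivations io)) <= 4 * qcdcl_size io)%N.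
Proof.
case=> -[m0 szl szd] lastC trl _ _; set ds := derivations io in szd trl *.
set ts := trails io in m0 szl szd trl *; set ls := learned io in szl lastC trl *.
set Q := qprefix Phi in trl.
(* Invariant after [i] trails. Its second part allows learned clauses as antecedents; its last part
   identifies the clause finally proved. *)
have main i : (i <= size ts)%N ->
  [/\ derivation (mode_ok R) Phi (flatten (take i ds)),
      (forall A, A \in take i ls -> A \in flatten (take i ds) /\ red Q A = A),
      (size (flatten (take i ds)) <= 4 * sumn (map size (take i ts)))%N &
      last fset0 (flatten (take i ds)) = last fset0 (take i ls)].
  elim: i => [_|i IH lti]; first by rewrite !take0.
  have [der mem sz _] := IH (ltnW lti); have [tr _ lr] := trl i lti.
  have justS A pi : A \in qmatrix Phi `|` [fset D in take i ls] ->
      justified (mode_ok R) Phi (flatten (take i ds) ++ pi) A.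
    rewrite !inE => /orP[?|/mem[Af rA]]; first exact: Or31.
    by apply: Or33; exists A; rewrite ?rA // mem_cat Af.
  have [[dpi rD [pi' epi]] szpi] := learnable_derived tr der justS lr.
  rewrite !(take_nth fset0) ?(take_nth [::]) ?szl ?szd // -!cats1.
  rewrite map_cat flatten_cat sumn_cat /= addn0 cats0 mulnDr; split=> //.
  - move=> A; rewrite !mem_cat inE => /orP[/mem[-> ->]//|/eqP->].
    by rewrite rD epi mem_rcons mem_head orbT.
  - by rewrite size_cat leq_add.
  - by rewrite epi !last_cat last_rcons.
have [] := main _ (leqnn _); rewrite !take_oversize ?szl ?szd // lastC.
move=> der mem sz lst; split=> //; split=> //.
(* An empty concatenation could not contain the first learned clause. *)
rewrite lt0n size_eq0; apply/eqP => e; rewrite e in mem.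
case els: ls szl => [|A ls'] szl; first by rewrite -szl in m0.
by have [] := mem A; rewrite ?els ?mem_head.
Qed.

(** * The transformation is computed by a finite transducer *)

Section Transducer.
Variables (A St : finType) (next : St -> A -> St) (keep : St -> A -> bool).
Variable start : St.

Fixpoint transduce (q : St) (w : seq A) : seq A :=
  if w is a :: w' then
    if keep q a then a :: transduce (next q a) w' else transduce (next q a) w'
  else [::].

Lemma transduce_cat q w1 w2 :
  transduce q (w1 ++ w2) = transduce q w1 ++ transduce (foldl next q w1) w2.
Proof. by elim: w1 q => //= a w1 IH q; case: ifP; rewrite IH. Qed.

Lemma transduce_const q w :
  {in w, forall a, next q a = q} -> foldl next q w = q /\
  transduce q w = filter (keep q) w.
Proof.
elim: w => //= a w IH h; rewrite h ?mem_head //.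
have [|-> ->] := IH; last by case: ifP.
by move=> b bw; apply: h; rewrite inE bw orbT.
Qed.

Let Sig : Type := option (A + void).

(** [None] is the halting state, entered at the first blank of the input. For a dropped symbol the
    output head writes a blank and stays. *)
Definition transducer_trans (q : option St) (r : {ffun 'I_2 -> Sig}) :
    option St * ('I_2 -> Sig * move) :=
  match q, r ord0 with
  | Some q', Some (inl a) =>
      (Some (next q' a), fun i =>
         if i == ord0 then (r ord0, GoRight)
         else if keep q' a then (Some (inl a), GoRight) else (None, Stay))
  | _, _ => (None, fun i => (r i, Stay))
  end.

Definition transducer : tm A :=
  @TM A 1 void (option St) (Some start) (fun q => q == None) transducer_trans.

Lemma transducer_run (w : seq A) (q : St) (c : config transducer)
    (out : seq A) (b : nat) :
  c.1 = Some q -> (c.2 ord0).2 = word transducer w ->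
  c.2 ord_max = (rev (word transducer out), nseq b None) ->
  let e := iter (size w).+1 (@tm_step A transducer) c in
  tm_halt e.1 /\ tm_output e (out ++ transduce q w).
Proof.
elim: w q c out b => [|a w IH] q [st tp] out b /= -> r0 r1.
  rewrite /tm_step /= ffunE /read r0 /=; split=> //.
  (* Even writing back a blank makes the scanned cell explicit, so at least one trailing blank
     remains. *)
  exists 0, (maxn b 1); rewrite /= ffunE /read /write r1 /= revK cats0.
  by case: b {r1}.
pose c : config transducer := (Some q, tp).
pose c' : config transducer := (Some (next q a), fun i =>
  write (tp i) (if i == ord0 then (Some (inl a), GoRight)
    else if keep q a then (Some (inl a), GoRight) else (None, Stay))).
have ec : tm_step c = c'.
  by rewrite /tm_step /= /transducer_trans ffunE /read r0.
rewrite -/c -[tm_step (tm_step _)]/(iter (size w).+2 (@tm_step A transducer) c).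
rewrite iterSr ec {ec}.
have r0' : (c'.2 ord0).2 = word transducer w by rewrite /= /write /= r0.
case: ifP => ka.
  (* The copied symbol overwrites the first explicit blank, if there is one. *)
  rewrite -cat_rcons; apply: (IH _ _ _ b.-1) => //=.
  by rewrite r1 /write /= ka /word map_rcons rev_rcons; case: (b).
apply: (IH _ _ _ (maxn b 1)) => //=.
by rewrite r1 /write /= ka; case: (b) => // n; rewrite /maxn; case: n.
Qed.

Lemma transduce_polytime : polytime (transduce start).
Proof.
(* One step per input symbol and one to halt. *)
exists transducer, 1, 1 => w; rewrite mul1n expn1 addn1.
exact: (@transducer_run w start _ [::] 0).
Qed.

End Transducer.

(** * Extraction of the derivations from a proof word *)

Definition ends_section (a : symbol) : bool :=
  if a is EndSection then true else false.
Definition ends_seq (a : symbol) : bool :=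
  if a is EndSeq then true else false.

(* The state counts, in binary and up to 3, the sections that have been read. *)
Definition next_section (q : bool * bool) (a : symbol) : bool * bool :=
  if ends_section a then (q.1 || q.2, q.1 || ~~ q.2) else q.
(** The formula is copied with its terminator, the trails and the learned clauses are dropped, and
    deleting the [EndSeq] separators concatenates the derivations. *)
Definition keep_symbol (q : bool * bool) (a : symbol) : bool :=
  match q with
  | (false, false) => true
  | (true, true) => ~~ ends_seq a
  | _ => false
  end.

Definition extract_derivations : seq symbol -> seq symbol :=
  transduce next_section keep_symbol (false, false).

Definition payload (a : symbol) : bool := ~~ ends_section a && ~~ ends_seq a.

Lemma all_flatten_map (T : Type) (p : pred symbol) (f : T -> seq symbol) s :
  (forall x, all p (f x)) -> all p (flatten (map f s)).
Proof. by move=> h; elim: s => //= x s IH; rewrite all_cat h. Qed.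

Lemma payload_var x : all payload (enc_var x).
Proof. by rewrite /enc_var; case: bin_of_nat => //; elim. Qed.

Lemma payload_lit l : all payload (enc_lit l).
Proof. by rewrite all_rcons payload_var. Qed.

Lemma payload_clause C : all payload (enc_clause C).
Proof. by rewrite all_rcons /=; apply: all_flatten_map payload_lit. Qed.

Lemma payload_clauses s : all payload (enc_clauses s).
Proof. exact: all_flatten_map payload_clause. Qed.

Lemma payload_block b : all payload (enc_block b).
Proof.
rewrite all_rcons /=; apply: all_flatten_map => x.
by rewrite all_rcons payload_var.
Qed.

Lemma section_trail T : all (predC ends_section) (enc_trail T).
Proof.
rewrite all_rcons /=; apply: all_flatten_map => it.
apply/allP => a; case: it => [l|l C|C] /=; rewrite inE ?mem_cat;
  move=> /predU1P[->//|]; rewrite -?mem_cat.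
all: move=> h; suff /andP[] : payload a by [].
all: move: a h; apply/allP.
- exact: payload_lit.
- by rewrite all_cat payload_lit payload_clause.
- exact: payload_clause.
Qed.

Lemma transduce_section q w : all (predC ends_section) w ->
  foldl next_section q w = q /\
  transduce next_section keep_symbol q w = filter (keep_symbol q) w.
Proof.
move=> /allP h; apply: transduce_const => a /h /=.
by rewrite /next_section; case: ends_section.
Qed.

(** The terminator is still read in state [q], so it shares the fate of its section. *)
Lemma transduce_end_section q w1 w2 : all (predC ends_section) w1 ->
  transduce next_section keep_symbol q (rcons w1 EndSection ++ w2) =
  filter (keep_symbol q) (rcons w1 EndSection) ++
  transduce next_section keep_symbol (next_section q EndSection) w2.
Proof.
move=> /transduce_section - /(_ q) [fq tq]; rewrite -cats1 -catA transduce_cat.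
by rewrite fq tq filter_cat -catA /=; case: ifP.
Qed.

Lemma extract_derivations_enc Phi io :
  extract_derivations (enc_qcdcl_proof Phi io) =
  enc_res_proof Phi (flatten (derivations io)).
Proof.
have sub : subpred payload (predC ends_section) by move=> a /andP[].
rewrite /extract_derivations /enc_qcdcl_proof /enc_res_proof.
rewrite transduce_end_section; last first.
  rewrite all_cat; apply/andP; split; last exact: sub_all sub _ (payload_clauses _).
  by apply: all_flatten_map => b; apply: sub_all sub _ (payload_block b).
rewrite (eq_filter (a2 := predT)) // filter_predT; congr (_ ++ _).
rewrite transduce_end_section; last exact: all_flatten_map section_trail.
rewrite (eq_filter (a2 := pred0)) // filter_pred0 cat0s.
rewrite transduce_end_section; last exact: sub_all sub _ (payload_clauses _).
rewrite (eq_filter (a2 := pred0)) // filter_pred0 cat0s.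
have [|_ ->] := transduce_section (true, true) (w := flatten
    [seq rcons (enc_clauses pi) EndSeq | pi <- derivations io]).
  apply: all_flatten_map => pi; rewrite all_rcons /=.
  exact: sub_all sub _ (payload_clauses _).
elim: (derivations io) => //= pi ds IH.
rewrite filter_cat IH filter_rcons /= /enc_clauses map_cat flatten_cat.
congr (_ ++ _); apply/all_filterP; apply: sub_all _ _ (payload_clauses pi).
by move=> a /andP[].
Qed.

(** * Soundness of long-distance Q-resolution *)

Lemma in_prefixE Q x : in_prefix Q x = existential Q x || universal Q x.
Proof.
by elim: Q => //= -[[] X] Q ->; case: (x \in X) => //=; rewrite ?orbT.
Qed.

Lemma pairwise_nth_disjoint (Q : qbf_prefix) b0 i j x :
  pairwise (fun b c : block => [disjoint b.2 & c.2]) Q ->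
  (i < size Q)%N -> (j < size Q)%N ->
  x \in (nth b0 Q i).2 -> x \in (nth b0 Q j).2 -> i = j.
Proof.
move=> /(pairwiseP b0) h li lj xi xj.
have aux a c : (a < size Q)%N -> (c < size Q)%N -> (a < c)%N ->
    x \in (nth b0 Q a).2 -> x \in (nth b0 Q c).2 -> False.
  by move=> la lc ac; have /fdisjointP := h _ _ la lc ac; move=> d /d/negP.
by case: (ltngtP i j) => // lt; [case: (aux i j) | case: (aux j i)].
Qed.

Lemma in_above Q (k : nat) (C : clause) (l : lit) :
  (l \in [fset m in C | (k < lv Q m.1)%N]) = (l \in C) && (k < lv Q l.1)%N.
Proof. by rewrite !inE. Qed.

Section Soundness.
Variable Phi : qcnf.
Let Q := qprefix Phi.
Let b0 : block := (true, fset0).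

Let disjQ : pairwise (fun b c : block => [disjoint b.2 & c.2]) Q.
Proof. by have /andP[/and3P[]] := qcnf_wf Phi. Qed.

(** Positions of blocks start at 0 but levels at 1; disjointness makes the block of a variable
    unique. *)
Lemma lv_block x k : (k < size Q)%N -> x \in (nth b0 Q k).2 -> lv Q x = k.+1.
Proof.
move=> lk xk; have hx : has (fun b : block => x \in b.2) Q.
  by apply/hasP; exists (nth b0 Q k); rewrite ?mem_nth.
congr _.+1; apply: (pairwise_nth_disjoint disjQ (b0 := b0) _ lk _ xk).
  by rewrite -has_find.
exact: (nth_find b0 hx).
Qed.

Lemma block_lv x k : in_prefix Q x -> lv Q x = k.+1 ->
  (k < size Q)%N /\ x \in (nth b0 Q k).2.
Proof. by move=> hx [<-]; rewrite -has_find; split=> //; apply: (nth_find b0 hx). Qed.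

Lemma existential_block x k : (k < size Q)%N -> x \in (nth b0 Q k).2 ->
  existential Q x = (nth b0 Q k).1 /\ universal Q x = ~~ (nth b0 Q k).1.
Proof.
move=> lk xk.
have aux (p : pred bool) :
    has (fun b : block => p b.1 && (x \in b.2)) Q = p (nth b0 Q k).1.
  apply/hasP/idP => [[b bQ /andP[pb xb]]|pk].
    have lb : (index b Q < size Q)%N by rewrite index_mem.
    suff <- : index b Q = k by rewrite nth_index.
    by apply: (pairwise_nth_disjoint disjQ (b0 := b0) lb lk _ xk); rewrite nth_index.
  by exists (nth b0 Q k); rewrite ?mem_nth ?pk.
by split; [exact: (aux id) | exact: (aux negb)].
Qed.

Lemma matrix_clause C : C \in qmatrix Phi ->
  ~~ taut C /\ forall l, l \in C -> in_prefix Q l.1.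
Proof.
have /andP[_ /allP h] := qcnf_wf Phi.
by move=> /h/andP[-> /allP].
Qed.

(* Derivability of a clause from the matrix under the assignment [s] of the
   first [k] blocks. *)
Inductive der (k : nat) (s : var -> bool) : clause -> Prop :=
  | DerAxiom C : C \in qmatrix Phi ->
      (forall l : lit, l \in C -> (lv Q l.1 <= k)%N -> s l.1 <> l.2) ->
      der k s [fset l in C | (k < lv Q l.1)%N]
  | DerRes l C D : der k s C -> der k s D -> can_resolve Q l C D ->
      ldqres_ok Q l C D -> der k s (resolvent l C D)
  | DerRed C : der k s C -> der k s (red Q C).

Lemma der_lits k s C (l : lit) :
  der k s C -> l \in C -> in_prefix Q l.1 /\ (k < lv Q l.1)%N.
Proof.
move=> dC; elim: dC l => [{}C CP _ l|p C1 C2 _ IH1 _ IH2 _ _ l|{}C _ IH l].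
- by rewrite !inE /= => /andP[/(proj2 (matrix_clause CP)) ? ?].
- by rewrite in_resolvent => /orP[/andP[_ /IH1]|/andP[_ /IH2]].
- by move=> /red_sub/IH.
Qed.

(* Universal literals of the outermost block cannot be merged, since they are
   not to the right of any pivot. *)
Lemma der_outer_nontaut k s C (l : lit) :
  der k s C -> lv Q l.1 = k.+1 -> l \in C -> neg l \in C -> False.
Proof.
move=> dC lvl; elim: dC l lvl => [{}C CP _|p C1 C2 d1 IH1 d2 IH2 cr ok|{}C _ IH] l lvl.
- rewrite !inE /= => /andP[lC _] /andP[nlC _].
  by have [/tautP + _] := matrix_clause CP; apply; exists l.
- move=> lE nE; have [_ lt] := ok l lE nE.
  have occ (D : clause) : l \in D \/ neg l \in D -> occurs l.1 D.
    by move=> h; apply/occursP; case: h => h; [exists l | exists (neg l)].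
  have kp : (k < lv Q p.1)%N.
    by have /and5P[_ pC _ _ _] := cr; have [] := der_lits d1 pC.
  have notboth : occurs l.1 C1 -> occurs l.1 C2 -> False.
    by move=> o1 o2; have := lt o1 o2; rewrite lvl ltnS leqNgt kp.
  move: lE nE; rewrite !in_resolvent.
  move=> /orP[/andP[_ l1]|/andP[_ l2]] /orP[/andP[_ n1]|/andP[_ n2]].
  + exact: IH1 l1 n1.
  + by apply: notboth; apply: occ; [left | right].
  + by apply: notboth; apply: occ; [right | left].
  + exact: IH2 l2 n2.
- by move=> /red_sub lC /red_sub; apply: IH lC.
Qed.

Definition satisfied (k : nat) (t : var -> bool) (C : clause) : Prop :=
  exists l : lit, [/\ l \in C, lv Q l.1 = k.+1 & t l.1 = l.2].

Definition agree (k : nat) (s t : var -> bool) : Prop :=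
  forall x, x \notin (nth b0 Q k).2 -> t x = s x.

(** Restricting a derivation by an assignment of the next block yields subclauses, unless a clause
    becomes satisfied. The third alternative arises when a reduction deletes the satisfied literal:
    the clause is then purely universal, and another assignment of the block refutes it. *)
Lemma der_step k s C : (k < size Q)%N -> der k s C ->
  forall t, agree k s t ->
  [\/ satisfied k t C,
      (exists2 C', der k.+1 t C' &
         {subset C' <= [fset l in C | (k.+1 < lv Q l.1)%N]})
    | ~~ (nth b0 Q k).1 /\ exists2 t', agree k s t' & der k.+1 t' fset0].
Proof.
move=> ltk; elim=> [{}C CP fC|p C1 C2 d1 IH1 d2 IH2 cr ok|{}C dC IH] t ag.
- have [/hasP[l lC /andP[/eqP lvl /eqP tl]]|/hasPn nsat] := boolP (has
      (fun l : lit => (lv Q l.1 == k.+1) && (t l.1 == l.2)) (enum_fset C)).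
    by apply: Or31; exists l; split=> //; rewrite !inE lC /= lvl.
  apply: Or32; exists [fset l in C | (k.+1 < lv Q l.1)%N].
    apply: DerAxiom => // l lC; rewrite leq_eqVlt => /predU1P[lvl|lvl] tl.
      by have := nsat l lC; rewrite lvl tl !eqxx.
    apply: (fC l lC lvl); rewrite -ag //; apply/negP => /(lv_block ltk) e.
    by rewrite e ltnn in lvl.
  move=> l; rewrite !inE /= => /andP[-> lt]; rewrite lt /= andbT.
  exact: ltnW lt.
- have [exp p1 np1 np2 p2] := and5P cr.
  have sat1 : satisfied k t C1 -> t p.1 <> p.2 \/ lv Q p.1 <> k.+1 ->
      satisfied k t (resolvent p C1 C2).
    move=> [l [lC lvl tl]] h; exists l; split=> //; rewrite in_resolvent lC.
    by rewrite andbT; case: eqP => // e; rewrite -e lvl tl in h; case: h.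
  have sat2 : satisfied k t C2 -> t p.1 = p.2 \/ lv Q p.1 <> k.+1 ->
      satisfied k t (resolvent p C1 C2).
    move=> [l [lC lvl tl]] h; exists l; split=> //; rewrite in_resolvent lC.
    rewrite andbT; case: (l =P neg p) => [e|]; last by rewrite orbT.
    by move: lvl tl; rewrite e /= => lvl tl; case: h => //; rewrite tl; case: (p.2).
  have sub1 (C' : clause) : {subset C' <= [fset l in C1 | (k.+1 < lv Q l.1)%N]} ->
      p \notin C' ->
      {subset C' <= [fset l in resolvent p C1 C2 | (k.+1 < lv Q l.1)%N]}.
    move=> sb pC l lC; have := sb l lC; rewrite !inE /= => /andP[-> ->].
    by case: (l =P p) => // e; rewrite -e lC in pC.
  have sub2 (C' : clause) : {subset C' <= [fset l in C2 | (k.+1 < lv Q l.1)%N]} ->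
      neg p \notin C' ->
      {subset C' <= [fset l in resolvent p C1 C2 | (k.+1 < lv Q l.1)%N]}.
    move=> sb pC l lC; have := sb l lC; rewrite !inE /= => /andP[-> ->].
    by case: (l =P neg p) => [e|]; [rewrite -e lC in pC | rewrite orbT].
  have out (l : lit) (D D' : clause) : lv Q l.1 = k.+1 ->
      {subset D' <= [fset m in D | (k.+1 < lv Q m.1)%N]} -> l \notin D'.
    by move=> lvl sb; apply/negP => /sb; rewrite !inE /= lvl ltnn andbF.
  (* If [t] assigns the pivot, the parent whose pivot literal is false replaces the resolvent. *)
  have [lvp|lvp] := eqVneq (lv Q p.1) k.+1.
    have [tp|/eqP tp] := eqVneq (t p.1) p.2.
      case: (IH2 t ag) => [st|[C' dC' sb]|]; last exact: Or33.
        by apply: Or31; apply: sat2 => //; left.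
      by apply: Or32; exists C' => //; exact: (sub2 _ sb (out (neg p) _ _ lvp sb)).
    case: (IH1 t ag) => [st|[C' dC' sb]|]; last exact: Or33.
      by apply: Or31; apply: sat1 => //; left.
    by apply: Or32; exists C' => //; exact: (sub1 _ sb (out _ _ _ lvp sb)).
  move/eqP: lvp => lvp.
  case: (IH1 t ag) => [st|[C1' dC1' sb1]|]; last exact: Or33.
    by apply: Or31; apply: sat1 => //; right.
  case: (IH2 t ag) => [st|[C2' dC2' sb2]|]; last exact: Or33.
    by apply: Or31; apply: sat2 => //; right.
  (* A restricted parent that has lost its pivot literal is already a subclause of the resolvent;
     otherwise the two are resolved again. *)
  have [p1'|p1'] := boolP (p \in C1'); last first.
    by apply: Or32; exists C1' => //; exact: (sub1 _ sb1).
  have [p2'|p2'] := boolP (neg p \in C2'); last first.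
    by apply: Or32; exists C2' => //; exact: (sub2 _ sb2).
  have in1 l : l \in C1' -> l \in C1 by move=> /sb1; rewrite !inE => /andP[].
  have in2 l : l \in C2' -> l \in C2 by move=> /sb2; rewrite !inE => /andP[].
  have inE' l : l \in resolvent p C1' C2' -> l \in resolvent p C1 C2.
    rewrite !in_resolvent => /orP[/andP[-> /in1->]//|/andP[-> /in2->]].
    by rewrite orbT.
  apply: Or32; exists (resolvent p C1' C2').
    apply: DerRes => //.
      rewrite /can_resolve exp p1' p2' /=; apply/andP; split.
        by apply: contra np1 => /in1.
      by apply: contra p2 => /in2.
    move=> u /inE' uE /inE' nuE; have [? h] := ok u uE nuE; split=> //.
    move=> /occursP[w /in1 ? ?] /occursP[w' /in2 ? ?].
    by apply: h; apply/occursP; [exists w | exists w'].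
  move=> l lE; have := inE' l lE; rewrite !inE /= => ->.
  move: lE; rewrite in_resolvent.
  by move=> /orP[/andP[_ /sb1]|/andP[_ /sb2]]; rewrite !inE => /andP[].
- have redsub (C' : clause) : {subset C' <= [fset l in C | (k.+1 < lv Q l.1)%N]} ->
      {subset red Q C' <= [fset l in red Q C | (k.+1 < lv Q l.1)%N]}.
    move=> sb l lr; have /sb := red_sub lr; rewrite !in_above => /andP[_ ->].
    rewrite andbT; apply: red_mono lr => m /sb.
    by rewrite in_above => /andP[].
  case: (IH t ag) => [[l [lC lvl tl]]|[C' dC' sb]|]; last exact: Or33; last first.
    by apply: Or32; exists (red Q C'); [apply: DerRed | apply: redsub].
  have [lr|lr] := boolP (l \in red Q C); first by apply: Or31; exists l.
  have [ul _ hx] := red_removed lC lr.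
  (* An existential literal of [C] would have level at most [k], but all levels in [C] exceed
     [k]. *)
  have nex (x : lit) : x \in C -> ~~ existential Q x.1.
    move=> xC; apply/negP => ex; have := hx x xC ex; rewrite lvl ltnS.
    by have [_] := der_lits dC xC; rewrite ltnNge => /negP.
  have [_ lk] := block_lv (proj1 (der_lits dC lC)) lvl.
  have [_ ub] := existential_block ltk lk; rewrite ul in ub.
  (* This falsifies every literal of [C] in the block, by [der_outer_nontaut]; what remains of [C]
     is universal and reduces to the empty clause. *)
  pose t' x := if x \in (nth b0 Q k).2 then (x, false) \in C else s x.
  have ag' : agree k s t' by move=> x /negbTE h; rewrite /t' h.
  apply: Or33; split=> //.
  case: (IH t' ag') => [[m [mC lvm]]|[C' dC' sb]|[]//].
    have [_ mk] := block_lv (proj1 (der_lits dC mC)) lvm.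
    rewrite /t' mk; case: m mC lvm {mk} => x [] mC lvm /= h.
      by case: (der_outer_nontaut dC lvm mC).
    by rewrite mC in h.
  exists t' => //; suff <- : red Q C' = fset0 by apply: DerRed.
  apply/fsetP => m; rewrite in_fset0; apply/negP => /in_red[mC' h].
  have inC x : x \in C' -> x \in C by move=> /sb; rewrite !inE => /andP[].
  have := proj1 (der_lits dC (inC m mC')); rewrite in_prefixE.
  rewrite (negbTE (nex m (inC m mC'))) /= => /h[x [/inC/nex]].
  by move=> /negP.
Qed.

(** Induction on the number of unassigned blocks, keeping a derivation of the empty clause along a
    play against the semantics. *)
Lemma der_refutes k s : (k <= size Q)%N ->
  sem (qmatrix Phi) (drop k Q) s -> der k s fset0 -> False.
Proof.
move ej: (size Q - k)%N => j; elim: j k s ej => [|j IH] k s ej lek.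
  have ek : k = size Q by apply/eqP; rewrite eqn_leq lek -subn_eq0 ej.
  rewrite ek drop_size /= => tr d.
  suff [C CP fC] : exists2 C, C \in qmatrix Phi &
      forall l : lit, l \in C -> s l.1 <> l.2.
    by have [l lC sl] := tr C CP; case: (fC l lC).
  (* Any axiom at a leaf of the derivation will do: with all blocks assigned, every one of its
     literals is false. *)
  elim: d => [C CP fC|_ _ _ _ h _ _ _ _|_ _ h] //; exists C => // l lC.
  apply: fC => //; rewrite -has_find.
  by have [_ /(_ _ lC)] := matrix_clause CP.
have ltk : (k < size Q)%N by rewrite ltnNge -subn_eq0 ej.
have ej1 : (size Q - k.+1)%N = j by rewrite subnS ej.
rewrite (drop_nth b0 ltk); case eb: (nth b0 Q k) => [[] X] /=.
  move=> [t ag st] d; apply: (IH k.+1 t ej1 ltk st).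
  have ag' : agree k s t by rewrite /agree eb.
  case: (der_step ltk d ag') => [[l []]|[C' dC' sb]|]; first by rewrite in_fset0.
    suff <- : C' = fset0 by [].
    by apply/fsetP => l; rewrite in_fset0; apply/negP => /sb; rewrite !inE.
  by rewrite eb; case.
move=> st d; have agP t : agree k s t -> sem (qmatrix Phi) (drop k.+1 Q) t.
  by rewrite /agree eb => /st.
(* In a universal block [s] itself is tried first; if it fails, [der_step] supplies a refuting
   assignment. *)
have ags : agree k s s by [].
case: (der_step ltk d ags) => [[l []]|[C' dC' sb]|[_ [t ag dt]]].
- by rewrite in_fset0.
- apply: (IH k.+1 s ej1 ltk (agP s ags)); suff <- : C' = fset0 by [].
  by apply/fsetP => l; rewrite in_fset0; apply/negP => /sb; rewrite !inE.
- exact: IH k.+1 t ej1 ltk (agP t ag) dt.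
Qed.

Lemma ldqres_der C pi s : ldqres_proof Phi C pi -> der 0 s C.
Proof.
case=> pos <- h.
suff main i : (i < size pi)%N -> der 0 s (nth fset0 pi i).
  by rewrite -nth_last; apply: main; rewrite ltn_predL.
elim/ltn_ind: i => i IH lti.
have prev D : D \in take i pi -> der 0 s D.
  move=> /(nthP fset0)[j]; rewrite (size_takel (ltnW lti)) => ltj <-.
  by rewrite nth_take //; apply: IH => //; apply: ltn_trans ltj lti.
case: (h i lti) => [inP|[D1 [D2 [l [/prev d1 /prev d2 cr ok ->]]]]|[D /prev d ->]].
(* Levels are positive, so the restriction to levels above 0 keeps the whole clause. *)
- have -> : nth fset0 pi i = [fset l in nth fset0 pi i | (0 < lv Q l.1)%N].
    by apply/fsetP => l; rewrite !inE andbT.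
  exact: DerAxiom.
- exact: DerRes.
- exact: DerRed.
Qed.

Lemma ldqres_refutes pi : ldqres_proof Phi fset0 pi -> ~ qcnf_true Phi.
Proof.
move=> /(ldqres_der (fun=> false)) d tr.
by apply: (der_refutes (leq0n _) _ d); rewrite drop0.
Qed.

End Soundness.

Theorem theorem3p9 (P : policy) (R : redmode) :
  [/\ p_simulates LDQres (QCDCL P R),
      R = NoRed -> p_simulates Qres (QCDCL P R),
      exists c : nat, forall (Phi : qcnf) (C : clause) (io : qcdcl_pf),
        qcdcl_proof P R Phi C io ->
        (exists2 pi : seq clause, ldqres_proof Phi C pi &
           (size pi <= c * qcdcl_size io)%N) /\
        (R = NoRed -> exists2 pi : seq clause, qres_proof Phi C pi &
           (size pi <= c * qcdcl_size io)%N)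
    & sound (QCDCL P R)].
Proof.
(* The same concatenation, and so the same function on words, serves both target systems; under
   [NoRed] it is a Q-resolution proof and a fortiori a long-distance one. *)
have ld Phi C io : qcdcl_proof P R Phi C io ->
    ldqres_proof Phi C (flatten (derivations io)).
  by move=> /qcdcl_derivation[]; case: (R) => // /qres_ldqres.
have qr Phi C io : R = NoRed -> qcdcl_proof P R Phi C io ->
    qres_proof Phi C (flatten (derivations io)).
  by move=> eR /qcdcl_derivation[]; rewrite eR.
have pt : polytime extract_derivations by apply: transduce_polytime.
split.
- exists extract_derivations => // Phi C io /ld pf.
  by exists (flatten (derivations io)) => //; apply: extract_derivations_enc.
- move=> eR; exists extract_derivations => // Phi C io /(qr _ _ _ eR) pf.
  by exists (flatten (derivations io)) => //; apply: extract_derivations_enc.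
- exists 4 => Phi C io pf; have [_ sz] := qcdcl_derivation pf.
  split=> [|eR]; exists (flatten (derivations io)) => //; first exact: ld pf.
  exact: qr eR pf.
- by move=> Phi io /ld/ldqres_refutes.
Qed.
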